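(* For all $n$, $B_n(132,312)$ and $\widetilde B_n(123)$ are Gorenstein.
   Context: $M_\sigma$ is the permutation matrix of $\sigma$. $B_n(132,312)$ is the convex hull of $M_\sigma$ over $\sigma\in\mathfrak S_n$ avoiding $132$ and $312$; $\widetilde B_n(123)$ is the convex hull of $M_\sigma$ over alternating ($a_1<a_2>a_3<\cdots$) $123$-avoiding $\sigma=a_1\cdots a_n\in\mathfrak S_n$. Polytopes are regarded as lattice polytopes in their affine span with lattice $(\mathrm{aff}\,P)\cap\mathbb Z^{n\times n}$. A lattice polytope containing the origin in its interior is reflexive if its polar dual $\{x : x^Ty\le 1\ \forall y\in P\}$ is a lattice polytope; lattice translates of reflexive polytopes are also called reflexive. A lattice polytope $P$ is Gorenstein if $kP$ is reflexive for some positive integer $k$. *)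

(* Defs.v *)
From mathcomp Require Import all_boot all_order all_algebra all_fingroup.
From mathcomp Require Import all_classical all_reals.
From mathcomp Require Import topology normedtype.

Set Implicit Arguments.
Unset Strict Implicit.
Unset Printing Implicit Defensive.

Import Order.TTheory GRing.Theory Num.Theory.
Import numFieldNormedType.Exports.

Local Open Scope classical_set_scope.
Local Open Scope ring_scope.

(* A permutation s : 'S_n is read as the word s 0, s 1, ..., s (n - 1);
   positions and values are both numbered from 0.  A pattern is given by its
   one-line notation, of which only the relative order of the letters
   matters, e.g. [:: 1; 3; 2]%N. *)
Definition contains_pattern (p : seq nat) (n : nat) (s : 'S_n) : bool :=
  [exists f : {ffun 'I_(size p) -> 'I_n},
    [forall i : 'I_(size p), [forall j : 'I_(size p),
      ((i < j)%N ==> (f i < f j)%N) &&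
      ((s (f i) < s (f j))%N == (nth 0%N p i < nth 0%N p j)%N)]]].

Definition avoids (p : seq nat) (n : nat) (s : 'S_n) : bool :=
  ~~ contains_pattern p s.

(* Up-down permutations; because of the numbering from 0, the ascents are at
   the even positions. *)
Definition alternating (n : nat) (s : 'S_n) : bool :=
  [forall i : 'I_n, [forall j : 'I_n, (j == i.+1 :> nat) ==>
    (if odd i then (s j < s i)%N else (s i < s j)%N)]].

Section LatticePolytopes.
Variables (R : realType) (m n : nat).
Implicit Types (P S L : set 'M[R]_(m, n)) (x y t : 'M[R]_(m, n)).

Definition conv_hull S : set 'M[R]_(m, n) :=
  [set x | exists (k : nat) (v : 'I_k -> 'M[R]_(m, n)) (w : 'I_k -> R),
    [/\ forall i, S (v i), forall i, 0 <= w i, \sum_i w i = 1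
      & x = \sum_i w i *: v i]].

Definition aff_hull S : set 'M[R]_(m, n) :=
  [set x | exists (k : nat) (v : 'I_k -> 'M[R]_(m, n)) (w : 'I_k -> R),
    [/\ forall i, S (v i), \sum_i w i = 1 & x = \sum_i w i *: v i]].

Definition relint P : set 'M[R]_(m, n) :=
  [set x | aff_hull P x /\ within (aff_hull P) (nbhs x) P].

Definition dotmx x y : R := \sum_i \sum_j x i j * y i j.

(* The lattice of aff P. *)
Definition aff_lattice P : set 'M[R]_(m, n) :=
  [set x | aff_hull P x /\ x \is a mxOver Num.int].

Definition lattice_polytope_in L P : Prop :=
  exists2 V : set 'M[R]_(m, n),
    finite_set V /\ V `<=` L & P = conv_hull V.

Definition lattice_polytope P : Prop := lattice_polytope_in (aff_lattice P) P.

(* The next two definitions are meant for P with 0 \in aff P, so that aff P is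
   a vector space E with the full-rank lattice E `&` Z^(m x n).  The dual of E
   is identified with E through the scalar product; the dual lattice then
   consists of the x in E that take integral values on the lattice of E.  If
   E is the whole space, the dual lattice is Z^(m x n); in general it is not
   contained in Z^(m x n), but this is the lattice that corresponds to Z^d in
   dual coordinates when a lattice basis of E is used to identify E and its
   lattice with R^d and Z^d. *)
Definition dual_lattice P : set 'M[R]_(m, n) :=
  [set x | aff_hull P x /\
    forall y, aff_lattice P y -> dotmx x y \is a Num.int].

Definition polar_dual P : set 'M[R]_(m, n) :=
  [set x | aff_hull P x /\ forall y, P y -> dotmx x y <= 1].

Definition reflexive_at_origin P : Prop :=
  [/\ lattice_polytope P, relint P 0
    & lattice_polytope_in (dual_lattice P) (polar_dual P)].

Definition reflexive_polytope P : Prop :=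
  exists2 t, t \is a mxOver Num.int
           & reflexive_at_origin [set x - t | x in P].

Definition gorenstein P : Prop :=
  lattice_polytope P /\
  exists2 k : nat, (0 < k)%N & reflexive_polytope [set k%:R *: x | x in P].

End LatticePolytopes.

(* perm_mx s has its ones at the entries (i, s i). *)
Definition perm_polytope (R : realType) (n : nat) (A : pred 'S_n) :
    set 'M[R]_n :=
  conv_hull [set perm_mx s | s in [set s : 'S_n | A s]].

Definition B_132_312 (R : realType) (n : nat) : set 'M[R]_n :=
  @perm_polytope R n
    (fun s : 'S_n => avoids [:: 1; 3; 2]%N s && avoids [:: 3; 1; 2]%N s).

Definition Balt_123 (R : realType) (n : nat) : set 'M[R]_n :=
  @perm_polytope R n
    (fun s : 'S_n => alternating s && avoids [:: 1; 2; 3]%N s).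

Arguments B_132_312 : clear implicits.
Arguments Balt_123 : clear implicits.

(* Main.v *)
Require Import Defs.
From mathcomp Require Import all_boot all_order all_algebra all_fingroup.
From mathcomp Require Import all_classical all_reals.
From HB Require Import structures.
From mathcomp Require Import topology normedtype.
From mathcomp Require Import zify ring lra.
Import Defs.

(* Both polytopes are unimodularly equivalent to order polytopes.  A word
   avoiding 132 and 312 is encoded by the minima of its prefixes, an alternating
   word avoiding 123 by the number of its valleys below each value; in both
   cases this is a lattice path V with steps 0 and 1 between two boundary paths,
   and the numbers [s <= V c] are integral affine functions of the permutation
   matrix, and conversely.  The paths are therefore the filters of a poset of
   pairs (c, s), which is graded with all its maximal chains of the same length.
   For such a poset the rank function is a lattice point at lattice distance
   one from all the facets of a dilate of the order polytope.  By Farkas' lemma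
   the polar dual of the translated dilate is then the convex hull of 0 and the
   facet functionals, projected orthogonally to the linear span of the polytope
   in order to represent them by points of the span. *)

Set Implicit Arguments.
Unset Strict Implicit.
Unset Printing Implicit Defensive.

Import Order.TTheory GRing.Theory Num.Theory.
Import numFieldNormedType.Exports.

Local Open Scope classical_set_scope.
Local Open Scope ring_scope.

(** * Affine hulls, orthogonal projection and Farkas' lemma *)

Section Hulls.
Variables (R : realType) (m n : nat).
Implicit Types (S : set 'M[R]_(m, n)) (x y z t g : 'M[R]_(m, n)).

Lemma dotmxC x y : dotmx x y = dotmx y x.
Proof. by apply: eq_bigr => i _; apply: eq_bigr => j _; rewrite mulrC. Qed.

Lemma dotmx_is_scalar x : scalar (dotmx x).
Proof.
move=> a y z; rewrite /dotmx mulr_sumr -big_split; apply: eq_bigr => i _.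
rewrite mulr_sumr -big_split; apply: eq_bigr => j _ /=.
by rewrite !mxE mulrDr mulrCA.
Qed.

HB.instance Definition _ x :=
  GRing.isLinear.Build R 'M[R]_(m, n) R *%R (dotmx x) (dotmx_is_scalar x).

Lemma dotmxBl x y z : dotmx (x - y) z = dotmx x z - dotmx y z.
Proof. by rewrite ![dotmx _ z]dotmxC linearB. Qed.

Lemma dotmxx_eq0 x : dotmx x x = 0 -> x = 0.
Proof.
have sq_ge0 i : 0 <= \sum_j x i j * x i j.
  by apply: sumr_ge0 => j _; rewrite -expr2 sqr_ge0.
move=> x0; apply/matrixP => i j; rewrite mxE.
have /eqP : \sum_k x i k * x i k = 0.
  exact: (psumr_eq0P (fun i _ => sq_ge0 i) x0).
rewrite psumr_eq0 => [|k _]; last by rewrite -expr2 sqr_ge0.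
by move=> /allP/(_ j (mem_index_enum _)); rewrite mulf_eq0 orbb => /eqP.
Qed.

Lemma dotmx_int x y : x \is a mxOver Num.int -> y \is a mxOver Num.int ->
  dotmx x y \is a Num.int.
Proof.
move=> /mxOverP xZ /mxOverP yZ; apply: rpred_sum => i _.
by apply: rpred_sum => j _; apply: rpredM.
Qed.

(** The hulls are defined with ordinal indices; enumeration admits any finite index type, such as a
    type of dependent pairs. *)
Lemma aff_hull_comb S (T : finType) (v : T -> 'M[R]_(m, n)) (w : T -> R) :
  (forall i, S (v i)) -> \sum_i w i = 1 -> aff_hull S (\sum_i w i *: v i).
Proof.
move=> Sv w1; exists #|T|, (v \o enum_val), (w \o enum_val); split => //=.
- by rewrite -[RHS]w1; apply/esym; exact: (big_enum_val (A := T) w).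
- exact: (big_enum_val (A := T) (fun i => w i *: v i)).
Qed.

Lemma conv_hull_comb S (T : finType) (v : T -> 'M[R]_(m, n)) (w : T -> R) :
  (forall i, S (v i)) -> (forall i, 0 <= w i) -> \sum_i w i = 1 ->
  conv_hull S (\sum_i w i *: v i).
Proof.
move=> Sv w0 w1; exists #|T|, (v \o enum_val), (w \o enum_val); split => //=.
- by rewrite -[RHS]w1; apply/esym; exact: (big_enum_val (A := T) w).
- exact: (big_enum_val (A := T) (fun i => w i *: v i)).
Qed.

Lemma sub_conv_hull S : S `<=` conv_hull S.
Proof.
move=> x Sx; rewrite -[x]scale1r.
have := @conv_hull_comb S unit (fun=> x) (fun=> 1).
by rewrite !big_const card_unit /= !addr0; apply.
Qed.

Lemma conv_hull_sub_aff S : conv_hull S `<=` aff_hull S.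
Proof. by move=> x [k [v [w [Sv _ w1 ->]]]]; exists k, v, w; split. Qed.

Lemma sub_aff_hull S : S `<=` aff_hull S.
Proof. by move=> x /sub_conv_hull/conv_hull_sub_aff. Qed.

Lemma aff_hull_idem S : aff_hull (aff_hull S) = aff_hull S.
Proof.
apply/seteqP; split; last exact: sub_aff_hull.
move=> _ [k [v [w [Sv w1 ->]]]].
have Sv' i : exists d, exists p : ('I_d -> 'M[R]_(m, n)) * ('I_d -> R),
    [/\ forall j, S (p.1 j), \sum_j p.2 j = 1 & v i = \sum_j p.2 j *: p.1 j].
  by have [l [v' [w' ?]]] := Sv i; exists l, (v', w').
pose d i := projT1 (cid (Sv' i)); have dP i := projT2 (cid (Sv' i)).
pose p i := projT1 (cid (dP i)); have pP i := projT2 (cid (dP i)).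
(* The nested combination is indexed by pairs of an outer and an inner index, and the weights
   multiply. *)
pose W (x : {i : 'I_k & 'I_(d i)}) := w (tag x) * (p (tag x)).2 (tagged x).
pose X (x : {i : 'I_k & 'I_(d i)}) := (p (tag x)).1 (tagged x).
have -> : \sum_i w i *: v i = \sum_x W x *: X x.
  rewrite -(sig_big_dep xpredT (fun _ => xpredT) (fun i (j : 'I_(d i)) =>
    W (Tagged (fun i => 'I_(d i)) j) *: X (Tagged (fun i => 'I_(d i)) j))) /=.
  apply: eq_bigr => i _; have [_ _ ->] := pP i.
  by rewrite scaler_sumr; apply: eq_bigr => j _; rewrite scalerA.
apply: aff_hull_comb => [[i j]|]; first by have [+ _ _] := pP i; apply.
rewrite -w1 -(sig_big_dep xpredT (fun _ => xpredT) (fun i (j : 'I_(d i)) =>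
  W (Tagged (fun i => 'I_(d i)) j))) /=.
apply: eq_bigr => i _; have [_ p1 _] := pP i; rewrite /W /=.
by rewrite -mulr_sumr p1 mulr1.
Qed.

(** These are the linear subspaces. Lying in the span of a list is expressed as lying in every such
    set that contains the list. *)
Definition lin_closed (W : set 'M[R]_(m, n)) : Prop :=
  W 0 /\ forall (a : R) x y, W x -> W y -> W (a *: x + y).

Lemma aff_hull_lin_closed S : aff_hull S 0 -> lin_closed (aff_hull S).
Proof.
move=> S0; split=> // a x y Sx Sy; rewrite -aff_hull_idem.
(* The extra point 0 absorbs the weight [- a], so that the weights sum to 1. *)
have -> : a *: x + y =
    \sum_(i < 3) [:: a; 1; - a]`_i *: [:: x; y; 0]`_i.
  by rewrite !big_ord_recl big_ord0 /= scaler0 !addr0 scale1r.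
apply: aff_hull_comb => [[[|[|[|[]]]]]|] //.
by rewrite !big_ord_recl big_ord0 /=; ring.
Qed.

Lemma lin_closed_ortho x : lin_closed [set y | dotmx x y = 0].
Proof.
by split=> [|a y z /= xy xz]; rewrite /= ?linear0 // linearP /= xy xz mulr0 addr0.
Qed.

(** Gram-Schmidt: with e the component of v orthogonal to s, the projection of g to the span of
    [v :: s] is that to the span of s plus a multiple of e. *)
Lemma ortho_projection (s : seq 'M[R]_(m, n)) g : exists u,
  (forall W, lin_closed W -> (forall x, x \in s -> W x) -> W u) /\
  forall x, x \in s -> dotmx (g - u) x = 0.
Proof.
elim: s g => [|v s IHs] g; first by exists 0; split=> [W [W0 _]|].
have [p [ps vp0]] := IHs v; have [q [qs gq0]] := IHs g.
have [e eE] : exists e, e = v - p by exists (v - p).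
have [e0|e_neq0] := eqVneq e 0.
  exists q; split=> [W Wlin Ws|x].
    by apply: qs => // x xs; apply: Ws; rewrite inE xs orbT.
  rewrite inE => /predU1P[->|]; last exact: gq0.
  rewrite eE in e0; rewrite (subr0_eq e0).
  by apply: (ps _ (lin_closed_ortho _)) => y; exact: gq0.
have ee_neq0 : dotmx e e != 0 by apply: contra_neq e_neq0; apply: dotmxx_eq0.
exists (q + (dotmx g e / dotmx e e) *: e); split=> [W Wlin Ws|x].
  have Wsub x : x \in s -> W x by move=> xs; apply: Ws; rewrite inE xs orbT.
  rewrite addrC; apply: Wlin.2; last exact: qs.
  rewrite eE addrC -scaleN1r; apply: Wlin.2; first exact: ps.
  by apply: Ws; rewrite mem_head.
have ep : dotmx e p = 0.
  by apply: (ps _ (lin_closed_ortho _)) => y; rewrite eE; exact: vp0.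
have qe : dotmx e q = 0.
  by apply: (qs _ (lin_closed_ortho _)) => y; rewrite eE; exact: vp0.
have gp : dotmx (g - q) p = 0.
  by apply: (ps _ (lin_closed_ortho _)) => y; exact: gq0.
rewrite opprD addrA dotmxBl inE => /predU1P[->|xs]; last first.
  rewrite gq0 // [dotmx (_ *: _) _]dotmxC linearZ /= [dotmx x _]dotmxC.
  by rewrite eE (vp0 x) // mulr0 subrr.
have -> : v = e + p by rewrite eE subrK.
rewrite linearD /= gp addr0 dotmxBl [dotmx q e]dotmxC qe subr0.
rewrite [dotmx (_ *: _) _]dotmxC linearZ /= [dotmx (e + p) e]dotmxC.
by rewrite linearD /= ep addr0 divfK ?subrr.
Qed.

End Hulls.

(* The induction step projects along a vector that separates f from the first
   k forms, onto the kernel of the last one. *)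
Lemma farkas (R : realFieldType) (V : lmodType R) (k : nat)
    (u : 'I_k -> V -> R) (f : V -> R) :
  (forall i, scalar (u i)) -> scalar f ->
  (forall y, (forall i, u i y <= 0) -> f y <= 0) ->
  exists w : 'I_k -> R,
    (forall i, 0 <= w i) /\ forall y, f y = \sum_i w i * u i y.
Proof.
have liftE j (i : 'I_j) : lift ord_max i = widen_ord (leqnSn j) i.
  by apply: val_inj; rewrite /= /bump leqNgt ltn_ord.
have scalB (h : V -> R) a x y : scalar h -> h (y - a *: x) = h y - a * h x.
  by move=> hP; rewrite addrC -scaleNr hP mulNr addrC.
elim: k u f => [|k IHk] u f uP fP fu.
  exists (fun=> 0); split=> // y; rewrite big_ord0.
  have f0 z : f z <= 0 by apply: fu; case.
  (* Without forms the hypothesis holds for every vector, so f is also bounded at -y. *)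
  apply/eqP; rewrite eq_le f0 /=; have := f0 (0 - 1 *: y).
  have -> : f (0 - 1 *: y) = f 0 - 1 * f y by exact: scalB.
  have : f (0 - 1 *: 0) = f 0 - 1 * f 0 by exact: scalB.
  by rewrite scaler0 subr0; lra.
pose u' i := u (widen_ord (leqnSn k) i).
(* If the first k forms alone imply [f y <= 0], the last one gets weight 0; otherwise y0 is a
   counterexample to that implication. *)
have [[y0 [u'y0 fy0]]|sep] :=
    pselect (exists y, (forall i, u' i y <= 0) /\ 0 < f y); last first.
  have [|w [w0 fw]] := IHk u' f (fun i => uP _) fP.
    by move=> y u'y; rewrite leNgt; apply/negP => fy; apply: sep; exists y.
  exists (fun i => if unlift ord_max i is Some j then w j else 0); split=> [i|y].
    by case: unlift.
  rewrite big_ord_recr /= unlift_none mul0r addr0 fw; apply: eq_bigr => i _.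
  by rewrite -liftE liftK liftE.
have z_gt0 : 0 < u ord_max y0.
  rewrite ltNge; apply/negP => z_le0; have : f y0 <= 0; last by rewrite leNgt fy0.
  apply: fu => i; case: (unliftP ord_max i) => [j|] -> //.
  by rewrite liftE; exact: u'y0.
(* As z is 1 at y0, subtracting [z y *: y0] from y projects onto the kernel of the last form. *)
pose z y := u ord_max y / u ord_max y0.
have zP : scalar z by move=> a x y; rewrite /z uP; ring.
have [|||w [w0 fw]] := IHk (fun i y => u' i y - u' i y0 * z y)
    (fun y => f y - f y0 * z y).
- by move=> i a x y; rewrite zP /u' uP; ring.
- by move=> a x y; rewrite zP fP; ring.
- move=> y u'y; rewrite mulrC -scalB //; apply: fu => i.
  case: (unliftP ord_max i) => [j|] ->; last first.
    by rewrite scalB // /z divfK ?subrr // gt_eqF.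
  by rewrite liftE scalB // mulrC; exact: u'y.
(* Comparing the coefficients of [z y] gives this weight; it is nonnegative since [0 < f y0] and
   each [u' i y0 <= 0]. *)
pose w' := (f y0 - \sum_i w i * u' i y0) / u ord_max y0.
exists (fun i => if unlift ord_max i is Some j then w j else w'); split=> [i|y].
  case: unlift => [j|] //; rewrite divr_ge0 ?(ltW z_gt0) // subr_ge0.
  by rewrite (le_trans _ (ltW fy0)) // sumr_le0 // => j _; rewrite mulr_ge0_le0.
rewrite big_ord_recr /= unlift_none.
under eq_bigr => i _ do rewrite -liftE liftK liftE.
have /eqP := fw y; rewrite subr_eq => /eqP ->.
rewrite (eq_bigr (fun i => w i * u' i y - w i * u' i y0 * z y)); last first.
  by move=> i _; ring.
rewrite sumrB -mulr_suml /w' -mulrA -/(z y).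
rewrite /z; ring.
Qed.

(** * Reflexivity from a description by inequalities *)

Section Facets.
Variables (R : realType) (m n : nat).
Implicit Types (S : set 'M[R]_(m, n)) (x y z t : 'M[R]_(m, n)).

Lemma conv_hull_ind S (W : {scalar 'M[R]_(m, n)}) (b : R) x :
  (forall y, S y -> W y <= b) -> conv_hull S x -> W x <= b.
Proof.
move=> WS [k [v [w [Sv w0 w1 ->]]]].
rewrite linear_sum -[b]mul1r -w1 mulr_suml.
by apply: ler_sum => i _; rewrite linearZ /= ler_wpM2l ?w0 //; apply: WS.
Qed.

Lemma aff_hull_eq S (W : {scalar 'M[R]_(m, n)}) (b : R) x :
  (forall y, S y -> W y = b) -> aff_hull S x -> W x = b.
Proof.
move=> WS [k [v [w [Sv w1 ->]]]].
rewrite linear_sum -[b]mul1r -w1 mulr_suml.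
by apply: eq_bigr => i _; rewrite linearZ /= WS.
Qed.

Lemma lattice_polytope_conv_hull S :
  finite_set S -> (forall x, S x -> x \is a mxOver Num.int) ->
  lattice_polytope (conv_hull S).
Proof.
move=> Sfin SZ; exists S => //; split=> // x Sx; split; last exact: SZ.
exact/sub_aff_hull/sub_conv_hull.
Qed.

Lemma aff_hull_conv_hull S : aff_hull (conv_hull S) = aff_hull S.
Proof.
apply/seteqP; split=> x.
  rewrite -[aff_hull S]aff_hull_idem => -[k [v [w [Sv w1 ->]]]].
  by exists k, v, w; split=> // i; apply: conv_hull_sub_aff.
move=> [k [v [w [Sv w1 ->]]]]; exists k, v, w; split=> // i.
  exact: sub_conv_hull.
Qed.

Lemma ortho_projection_aff S g : finite_set S -> aff_hull S 0 ->
  exists u, aff_hull S u /\ forall y, aff_hull S y -> dotmx u y = dotmx g y.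
Proof.
move=> /finite_seqP[s sE] S0; have [u [us us0]] := ortho_projection s g.
exists u; split=> [|y Sy].
  apply: us; first exact: aff_hull_lin_closed.
  by move=> x xs; apply: sub_aff_hull; rewrite sE.
apply/eqP; rewrite eq_sym -subr_eq0 -dotmxBl; apply/eqP.
by apply: aff_hull_eq Sy => z; rewrite sE => /us0.
Qed.

Lemma near0_dotmx_le1 g :
  \forall x \near nbhs (0 : 'M[R]_(m, n)), dotmx g x <= 1.
Proof.
have dot_cont : continuous (dotmx g).
  apply: continuous_big => [|i _]; first exact: add_continuous.
  apply: continuous_big => [|j _]; first exact: add_continuous.
  move=> x; apply: cvgMl_tmp; first exact: (nbhs_filter x).
  exact: (@coord_continuous R m n i j x).
have : dotmx g x @[x --> (0 : 'M[R]_(m, n))] --> dotmx g 0 by exact: dot_cont.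
rewrite linear0 => dot0.
near=> x; apply: ltW; near: x; apply: cvgr_lt dot0 _ ltr01.
Unshelve. all: by end_near.
Qed.

(** Projecting [g f] to the span keeps its values there, so the projections lie in the polar dual
    and in the dual lattice. Conversely, Farkas' lemma on pairs (y, s) writes every point of the
    polar dual as a convex combination of them and 0. *)
Lemma reflexive_of_facets S (F : finType) (g : F -> 'M[R]_(m, n)) :
  finite_set S -> (forall x, S x -> x \is a mxOver Num.int) ->
  (forall f, g f \is a mxOver Num.int) -> aff_hull S 0 ->
  (forall f x, S x -> dotmx (g f) x <= 1) ->
  (forall x, aff_hull S x -> (forall f, dotmx (g f) x <= 1) -> conv_hull S x) ->
  reflexive_at_origin (conv_hull S).
Proof.
move=> Sfin SZ gZ S0 gS Sg; have affE := aff_hull_conv_hull S.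
have [u uE] : {u : F -> 'M[R]_(m, n) | forall f, aff_hull S (u f) /\
    forall y, aff_hull S y -> dotmx (u f) y = dotmx (g f) y}.
  pose p f := cid (ortho_projection_aff (g f) Sfin S0).
  by exists (fun f => projT1 (p f)) => f; exact: (projT2 (p f)).
have gconv f y : conv_hull S y -> dotmx (g f) y <= 1.
  by apply: conv_hull_ind => z; exact: gS.
have Slin := aff_hull_lin_closed S0.
split; first exact: lattice_polytope_conv_hull.
  split; rewrite affE //; suff : \forall x \near nbhs (0 : 'M[R]_(m, n)),
    forall f, dotmx (g f) x <= 1 by apply: filterS => x xg Sx; apply: Sg.
  by apply: filter_forall => f; exact: near0_dotmx_le1.
pose v := oapp u 0.
have vE o : aff_hull S (v o) by case: o => [f|] //=; have [] := uE f.
have v_polar o : polar_dual (conv_hull S) (v o).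
  split; rewrite ?affE // => y Sy; case: o => [f|] /=.
    by rewrite (uE f).2 ?gconv //; exact: conv_hull_sub_aff.
  by rewrite dotmxC linear0.
exists (range v).
  split; first exact/finite_image/finite_finset.
  move=> _ [o _ <-]; split; rewrite ?affE // => y [Sy yZ]; rewrite affE in Sy.
  case: o => [f|] /=; first by rewrite (uE f).2 // dotmx_int.
  by rewrite dotmxC linear0.
apply/seteqP; split=> x; last first.
  move=> xv; split; last first.
    move=> y Sy; rewrite dotmxC; apply: conv_hull_ind xv.
    by move=> _ [o _ <-] /=; rewrite dotmxC; have [_] := v_polar o; apply.
  rewrite affE -aff_hull_idem; case: xv => k [v' [w [Sv' _ w1 ->]]].
  exists k, v', w; split=> // i; have [o _ <-] := Sv' i; exact: vE.
move=> [xE xS]; rewrite affE in xE.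
(* The vector v None = 0 contributes the form -s, which excludes s < 0. *)
pose hom z (p : 'M[R]_(m, n) * R^o) : R := dotmx z p.1 - p.2.
have homP z : scalar (hom z).
  move=> a p q; rewrite /hom /= linearP /= -[a *: p.2]/(a * p.2); ring.
have [|w [w0 xw]] := @farkas R ('M[R]_(m, n) * R^o)%type #|{: option F}|
    (fun i => hom (v (enum_val i))) (hom x) (fun i => homP _) (homP _).
  move=> [y s] ys.
  have {}ys o : dotmx (v o) y <= s.
    by have := ys (enum_rank o); rewrite enum_rankK /hom /= subr_le0.
  have s_ge0 : 0 <= s by have := ys None; rewrite /= dotmxC linear0.
  (* Since x and all [v o] lie in the span, y may be replaced by its projection z. *)
  have [z [zE zP]] := ortho_projection_aff y Sfin S0.
  rewrite /hom /= subr_le0 dotmxC -zP // dotmxC.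
  have {}ys f : dotmx (g f) z <= s.
    have [uS uf] := uE f; rewrite -uf // dotmxC zP // dotmxC; exact: (ys (Some f)).
  (* The point [c *: z] lies in the polytope. For s > 0 take c = 1/s; for s = 0 every c >= 0 is
     allowed, which excludes a positive value at z. *)
  have zS (c : R) : 0 <= c -> c * s <= 1 -> c * dotmx x z <= 1.
    move=> c0 cs1; have <- : dotmx x (c *: z) = c * dotmx x z by rewrite linearZ.
    apply: xS; apply: Sg => [|f].
      by rewrite -[c *: z]addr0; apply: Slin.2.
    by rewrite linearZ /=; apply: le_trans cs1; rewrite ler_wpM2l.
  have [s_gt0|s_le0] := ltP 0 s.
    have := zS s^-1; rewrite invr_ge0 s_ge0 mulVf ?gt_eqF // => /(_ isT (lexx _)).
    by rewrite mulrC ler_pdivrMr // mul1r.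
  have s0 : s = 0 by apply: le_anti; rewrite s_le0.
  rewrite s0 leNgt; apply/negP => d_gt0.
  have := zS (2 / dotmx x z); rewrite s0 mulr0 divr_ge0 ?(ltW d_gt0) //.
  rewrite divfK ?gt_eqF // ler01.
  by move=> /(_ isT isT); lra.
exists #|{: option F}|, (v \o enum_val), w; split=> //= [i||].
- exact: imageT.
(* At (0, 1) the identity of forms says that the weights sum to 1. *)
- have := xw (0, 1); rewrite /hom /= linear0 sub0r.
  under eq_bigr do rewrite linear0 sub0r mulrN1.
  by rewrite sumrN => /oppr_inj.
(* With d the difference of x and the combination, the identity at (d, 0) gives [dotmx d d = 0]. *)
apply/subr0_eq/dotmxx_eq0; set d := x - _; rewrite {1}/d dotmxBl.
have := xw (d, 0); rewrite /hom /= subr0 => ->; apply/eqP.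
rewrite subr_eq0 [X in _ == X]dotmxC linear_sum; apply/eqP/eq_bigr => i _.
by rewrite subr0 linearZ /= dotmxC.
Qed.

End Facets.

(** * Order polytopes *)

Section Dilation.
Variables (R : realType) (m n : nat).
Implicit Types (S : set 'M[R]_(m, n)) (x y z t : 'M[R]_(m, n)).

Lemma affine_comb (k : nat) (v : 'I_k -> 'M[R]_(m, n)) (w : 'I_k -> R) a t :
  \sum_i w i = 1 ->
  a *: (\sum_i w i *: v i) - t = \sum_i w i *: (a *: v i - t).
Proof.
move=> w1; rewrite -{1}[t]scale1r -w1 scaler_suml scaler_sumr -sumrB.
by apply: eq_bigr => i _; rewrite scalerBr !scalerA mulrC.
Qed.

Lemma conv_hull_affine S a t x : conv_hull S x ->
  conv_hull [set a *: y - t | y in S] (a *: x - t).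
Proof.
move=> [k [v [w [Sv w0 w1 ->]]]]; rewrite affine_comb //.
exists k, (fun i => a *: v i - t), w; split=> // i; exact: imageP.
Qed.

Lemma aff_hull_affine S a t x : aff_hull S x ->
  aff_hull [set a *: y - t | y in S] (a *: x - t).
Proof.
move=> [k [v [w [Sv w1 ->]]]]; rewrite affine_comb //.
exists k, (fun i => a *: v i - t), w; split=> // i; exact: imageP.
Qed.

(** The inverse map is written in the same shape, so that the hull lemmas apply to it as well. *)
Lemma affineK S a t : a != 0 ->
  [set a^-1 *: z - (- a^-1 *: t) | z in [set a *: y - t | y in S]] = S.
Proof.
move=> a0; have K z : a^-1 *: (a *: z - t) - (- a^-1 *: t) = z.
  by rewrite scalerBr scalerA mulVf // scale1r scaleNr opprK subrK.
apply/seteqP; split=> [_ [_ [z Sz <-] <-]|z Sz]; first by rewrite K.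
by exists (a *: z - t); [exact: imageP|].
Qed.

(** The point t has lattice distance one from each bounding hyperplane of the k-th dilate, so
    translation by -t turns all right-hand sides into 1. *)
Lemma gorenstein_of_facets S (F : finType) (g : F -> 'M[R]_(m, n))
    (b : F -> R) (k : nat) t :
  (0 < k)%N -> finite_set S -> (forall x, S x -> x \is a mxOver Num.int) ->
  (forall f, g f \is a mxOver Num.int) -> t \is a mxOver Num.int ->
  aff_hull S (k%:R^-1 *: t) ->
  (forall f, dotmx (g f) t = k%:R * b f - 1) ->
  (forall f x, S x -> dotmx (g f) x <= b f) ->
  (forall x, aff_hull S x -> (forall f, dotmx (g f) x <= b f) ->
    conv_hull S x) ->
  gorenstein (conv_hull S).
Proof.
move=> k_gt0 Sfin SZ gZ tZ St gt gS Sg.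
split; first exact: lattice_polytope_conv_hull.
have k0 : k%:R != 0 :> R by rewrite pnatr_eq0 -lt0n.
have kR_gt0 : 0 < k%:R :> R by rewrite ltr0n.
pose S' := [set k%:R *: x - t | x in S].
exists k => //; exists t => //.
have -> : [set x - t | x in [set k%:R *: x | x in conv_hull S]] = conv_hull S'.
  apply/seteqP; split=> [_ [_ [x Sx <-] <-]|x S'x]; first exact: conv_hull_affine.
  exists (x + t); last by rewrite addrK.
  exists (k%:R^-1 *: x - (- k%:R^-1 *: t)).
    by rewrite -(affineK S t k0); apply: conv_hull_affine.
  by rewrite scaleNr opprK -scalerDr scalerA mulfV // scale1r.
apply: (@reflexive_of_facets _ _ _ _ _ g) => //.
- exact: finite_image.
- move=> _ [x Sx <-]; apply/mxOverP => i j; rewrite !mxE.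
  by rewrite rpredB ?rpredM ?rpred_nat ?(mxOverP (SZ _ Sx)) ?(mxOverP tZ).
- have := aff_hull_affine k%:R t St.
  by rewrite scalerA mulfV // scale1r subrr.
- move=> f _ [x Sx <-]; rewrite linearB linearZ /= gt.
  by have := gS f x Sx; rewrite -(ler_pM2l kR_gt0); lra.
move=> x S'x gx; have := aff_hull_affine k%:R^-1 (- k%:R^-1 *: t) S'x.
rewrite affineK // => /Sg Sx.
have {Sx} /(conv_hull_affine k%:R t) :
    conv_hull S (k%:R^-1 *: x - (- k%:R^-1 *: t)).
  apply: Sx => f; rewrite scaleNr opprK -scalerDr linearZ /= linearD /= gt.
  by rewrite -(ler_pM2l kR_gt0) mulrA mulfV // mul1r; have := gx f; lra.
by rewrite scaleNr opprK -scalerDr scalerA mulfV // scale1r addrK.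
Qed.

End Dilation.

Lemma layer_cake_seq (R : realFieldType) (a : R) (s : seq R) c :
  path <%R a s -> c \in a :: s ->
  c - a = \sum_(i < size s) (s`_i - (a :: s)`_i) * (s`_i <= c)%R%:R.
Proof.
elim: s a => [|b s IHs] a /=.
  by rewrite inE big_ord0 => _ /eqP ->; rewrite subrr.
move=> /andP[ab bs]; have /allP b_min := order_path_min lt_trans bs.
rewrite inE => /predU1P[->|c_bs]; last first.
  rewrite big_ord_recl /= -IHs //.
  have -> : b <= c by move: c_bs; rewrite inE => /predU1P[->//|/b_min/ltW].
  by rewrite mulr1; ring.
rewrite subrr big1 // => i _; rewrite [(_ <= a)]leNgt.
suff -> : a < (b :: s)`_i by rewrite mulr0.
case: i => -[|i] //= i_s; apply: lt_trans ab _; apply: b_min.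
by rewrite mem_nth.
Qed.

(** The thresholds are the positive values of z, together with 1 so that the weights, which are the
    gaps between consecutive thresholds starting from 0, sum to 1. *)
Lemma layer_cake (R : realFieldType) (I : finType) (z : I -> R) :
  (forall p, 0 <= z p <= 1) ->
  exists (k : nat) (c w : 'I_k -> R), [/\ forall i, 0 <= w i, \sum_i w i = 1
    & forall p, z p = \sum_i w i * (c i <= z p)%R%:R].
Proof.
move=> z01; pose s := sort <=%R (undup [seq c <- 1 :: codom z | 0 < c]).
have memE c : (c \in s) = (0 < c) && (c \in 1 :: codom z).
  by rewrite mem_sort mem_undup mem_filter.
have s_path : path <%R 0 s.
  have : sorted <%R s by rewrite sort_lt_sorted undup_uniq.
  case: s memE => //= b s' memE ->; rewrite andbT.
  by have := memE b; rewrite mem_head => /esym/andP[].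
have s_le1 c : c \in s -> c <= 1.
  rewrite memE inE => /andP[_ /predU1P[->//|/codomP[p ->]]].
  by have /andP[] := z01 p.
have s1 : 1 \in s by rewrite memE ltr01 mem_head.
exists (size s), (fun i => s`_i), (fun i => s`_i - (0 :: s)`_i); split.
- move=> i; rewrite subr_ge0; have /(pathP 0) := s_path.
  by move=> /(_ i (ltn_ord i))/ltW.
- have := layer_cake_seq s_path (c := 1); rewrite inE s1 orbT subr0 => ->//.
  by apply: eq_bigr => i _; rewrite s_le1 ?mulr1 // mem_nth.
move=> p; rewrite -(layer_cake_seq s_path) ?subr0 // inE memE.
have /andP[+ _] := z01 p; rewrite le_eqVlt eq_sym => /orP[->//|->] /=.
by rewrite inE codom_f !orbT.
Qed.

(* Order polytopes of graded posets (Hibi, Stanley): p lies below q when e p q,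
   rk is the rank function, and rk is the interior lattice point of the K-th
   dilation, at lattice distance one from every facet. *)
Theorem order_polytope_gorenstein (R : realType) (m n : nat) (T : Type)
    (v : T -> 'M[R]_(m, n)) (I : finType) (y : T -> I -> bool)
    (e : rel I) (rk : I -> nat) (K : nat) :
  (0 < K)%N -> finite_set (range v) ->
  (forall s, v s \is a mxOver Num.int) ->
  (forall p, exists2 g : 'M[R]_(m, n), g \is a mxOver Num.int
     & forall s, dotmx g (v s) = (y s p)%:R) ->
  (forall i j, exists (c : R) (a : I -> R), [/\ c \is a Num.int,
     forall p, a p \is a Num.int
     & forall s, v s i j = c + \sum_p a p * (y s p)%:R]) ->
  (forall p q, e p q -> rk q = (rk p).+1) ->
  (forall p, 0 < rk p < K)%N ->
  (forall p, rk p = 1%N \/ exists q, e q p) ->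
  (forall p, (rk p).+1 = K \/ exists q, e p q) ->
  (forall s p q, e p q -> y s p -> y s q) ->
  (forall b : I -> bool, (forall p q, e p q -> b p -> b q) ->
     exists s, y s =1 b) ->
  gorenstein (conv_hull (range v)).
Proof.
move=> K_gt0 vfin vZ yv vy e_rk rkK down up y_mono y_surj.
have [G GP] : {G : I -> 'M[R]_(m, n) | forall p, G p \is a mxOver Num.int /\
    forall s, dotmx (G p) (v s) = (y s p)%:R}.
  have yv' p : exists g : 'M[R]_(m, n), g \is a mxOver Num.int /\
      forall s, dotmx g (v s) = (y s p)%:R.
    by have [g ? ?] := yv p; exists g.
  by exists (fun p => projT1 (cid (yv' p))) => p; exact: (projT2 (cid (yv' p))).
(* On the affine hull the entries are affine in the numbers [dotmx (G p) x], which thus serve as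
   coordinates. *)
have entry i j : exists (c : R) (a : I -> R), [/\ c \is a Num.int,
    forall p, a p \is a Num.int & forall x, aff_hull (range v) x ->
    x i j = c + \sum_p a p * dotmx (G p) x].
  have [c [a [cZ aZ vE]]] := vy i j; exists c, a; split=> // x.
  move=> [k [u [w [Su w1 ->]]]].
  have -> : \sum_p a p * dotmx (G p) (\sum_l w l *: u l) =
      \sum_l w l * \sum_p a p * dotmx (G p) (u l).
    under [RHS]eq_bigr do rewrite mulr_sumr; rewrite exchange_big /=.
    apply: eq_bigr => p _; rewrite linear_sum mulr_sumr; apply: eq_bigr => l _.
    by rewrite linearZ /= mulrCA.
  rewrite -[c]mul1r -w1 mulr_suml -big_split summxE; apply: eq_bigr => l _ /=.
  rewrite mxE; have [s _ <-] := Su l; rewrite vE mulrDr.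
  by congr (_ + _ * _); apply: eq_bigr => p _; rewrite (GP p).2.
(* The superlevel sets of z are filters, hence realised by points [v s], and the layer cake combines
   these. *)
have lift z : (forall p, 0 <= z p <= 1) -> (forall p q, e p q -> z p <= z q) ->
    exists2 x, conv_hull (range v) x & forall p, dotmx (G p) x = z p.
  move=> z01 z_mono; have [k [c [w [w0 w1 zE]]]] := layer_cake z01.
  have s_ex i : exists s, y s =1 fun p => c i <= z p.
    by apply: y_surj => p q /z_mono zpq /le_trans; apply.
  pose s i := projT1 (cid (s_ex i)).
  exists (\sum_i w i *: v (s i)).
    by exists k, (v \o s), w; split=> // i; exact: imageT.
  move=> p; rewrite linear_sum zE; apply: eq_bigr => i _.
  by rewrite linearZ /= (GP p).2 (projT2 (cid (s_ex i))).
have KR_gt0 : 0 < K%:R :> R by rewrite ltr0n.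
have K0 : K%:R != 0 :> R by rewrite gt_eqF.
(* The dilate [K%:R *: x0] has the ranks as coordinates. *)
have [||x0 x0S x0E] := lift (fun p => (rk p)%:R / K%:R).
- move=> p; rewrite divr_ge0 ?ler0n //= ler_pdivrMr // mul1r ler_nat.
  by have /andP[_ /ltnW] := rkK p.
- by move=> p q /e_rk ->; rewrite ler_pM2r ?invr_gt0 // ler_nat.
(* The inequalities: coordinates are nonnegative at rank 1, at most 1 at rank K - 1, and increase
   along e. *)
pose F : finType := ({p : I | rk p == 1%N} + {p : I | (rk p).+1 == K} +
                     {pq : I * I | e pq.1 pq.2})%type.
pose g (f : F) := match f with
  | inl (inl p) => - G (val p)
  | inl (inr p) => G (val p)
  | inr pq => G (val pq).1 - G (val pq).2
  end.
pose b (f : F) : R := if f is inl (inr _) then 1 else 0.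
apply: (@gorenstein_of_facets _ _ _ _ F g b K (K%:R *: x0)) => //.
- by move=> _ [s _ <-].
- have GZ p i j : G p i j \is a Num.int by exact: (mxOverP (GP p).1).
  case=> [[p|p]|pq]; apply/mxOverP => i j /=; rewrite ?mxE //.
    by rewrite rpredN.
  by rewrite rpredB.
- apply/mxOverP => i j; rewrite mxE.
  have [c [a [cZ aZ ->]]] := entry i j; last exact: conv_hull_sub_aff.
  rewrite mulrDr mulr_sumr rpredD ?rpredM ?rpred_nat ?rpred_sum // => p _.
  by rewrite x0E mulrCA rpredM // mulrC divfK // rpred_nat.
- by rewrite scalerA mulVf // scale1r; exact: conv_hull_sub_aff.
- case=> [[[p /= /eqP rkp]|[p /= /eqP rkp]]|[[p q] /= epq]].
  + rewrite linearZ /= dotmxC linearN /= dotmxC x0E rkp mulrN mulrC.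
    by rewrite divfK // mulr0 sub0r.
  + by rewrite linearZ /= x0E mulrC divfK // -rkp; ring.
  + rewrite linearZ /= dotmxBl !x0E (e_rk _ _ epq) -mulrBl mulrC divfK //.
    by rewrite -natr1; ring.
- move=> f _ [s _ <-]; case: f => [[[p /= _]|[p /= _]]|[[p q] /= epq]].
  + by rewrite dotmxC linearN /= dotmxC (GP p).2 oppr_le0 ler0n.
  + by rewrite (GP p).2 lern1; case: (y s p).
  + rewrite dotmxBl !(GP _).2 subr_le0 ler_nat.
    by have := y_mono s _ _ epq; case: (y s p) => // ->.
move=> x Sx gx.
have x_mono p q : e p q -> dotmx (G p) x <= dotmx (G q) x.
  move=> epq; have := gx (inr (exist (fun pq => e pq.1 pq.2) (p, q) epq)).
  by rewrite /= dotmxBl subr_le0.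
(* The bound at rank 1 spreads upwards along chains; the bound 1 spreads downwards from rank K -
   1. *)
have x_ge0 p : 0 <= dotmx (G p) x.
  have [r] := ubnP (rk p); elim: r p => // r IHr p rkr.
  have [/eqP rk1|[q eqp]] := down p; last first.
    apply: le_trans (x_mono _ _ eqp); apply: IHr.
    by have := e_rk _ _ eqp; lia.
  have := gx (inl (inl (exist (fun p => rk p == 1%N) p rk1))).
  by rewrite /= dotmxC linearN /= dotmxC oppr_le0.
have x_le1 p : dotmx (G p) x <= 1.
  have [r] := ubnP (K - rk p)%N; elim: r p => // r IHr p rkr.
  have [/eqP rk1|[q epq]] := up p; last first.
    apply: le_trans (x_mono _ _ epq) _; apply: IHr.
    by have := e_rk _ _ epq; have := rkK q; lia.
  exact: (gx (inl (inr (exist (fun p => (rk p).+1 == K) p rk1)))).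
have [p||x' x'S x'E] := lift (fun p => dotmx (G p) x) => //.
  by rewrite /= x_ge0 x_le1.
suff -> : x = x' by [].
apply/matrixP => i j; have [c [a [_ _ xE]]] := entry i j.
rewrite !xE //; last exact: conv_hull_sub_aff.
by congr (_ + _); apply: eq_bigr => p _; rewrite x'E.
Qed.

(** * Lattice paths *)

Definition unit_steps (C : nat) (V : nat -> nat) : Prop :=
  (forall c, c < C -> V c <= V c.+1 <= (V c).+1)%N.

Definition lattice_path (C : nat) (lo hi V : nat -> nat) : Prop :=
  unit_steps C V /\ forall c, (c <= C -> lo c <= V c <= hi c)%N.

Lemma unit_steps_le (C : nat) (V : nat -> nat) a c :
  unit_steps C V -> (a <= c <= C -> V a <= V c <= V a + (c - a))%N.
Proof.
move=> Vs /andP[]; elim: c => [|c IHc] ac cC.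
  by move: ac; rewrite leqn0 => /eqP ->; lia.
move: ac; rewrite leq_eqVlt ltnS => /orP[/eqP ->|ac]; first by lia.
by have := Vs c cC; have := IHc ac (ltnW cC); lia.
Qed.

(** V rises at a step exactly when b holds one level higher there; the closure conditions then make
    each [b c] the initial segment up to [V c]. *)
Lemma path_of_filter (C : nat) (b : nat -> nat -> bool) :
  (forall s, b 0 s = (s == 0))%N ->
  (forall c s, c < C -> b c s -> b c.+1 s)%N ->
  (forall c s, c < C -> b c.+1 s.+1 -> b c s)%N ->
  exists2 V, unit_steps C V & forall c s, (c <= C)%N -> b c s = (s <= V c)%N.
Proof.
move=> b0 b_up b_dn.
pose V := fix V c := if c is c'.+1 then (V c' + b c (V c').+1)%N else 0%N.
have VS c : V c.+1 = (V c + b c.+1 (V c).+1)%N by [].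
exists V => [c cC|c]; first by rewrite VS; case: (b _ _); lia.
elim: c => [|c IHc] s cC; first by rewrite b0 leqn0.
have {}IHc := IHc _ (ltnW cC); rewrite VS.
have [sV|] := leqP s (V c).
  by rewrite b_up ?IHc //; lia.
case: s => // s; rewrite ltnS leq_eqVlt => /predU1P[->|Vs].
  by case: (b _ _); lia.
apply/idP/idP => [/(b_dn _ _ cC)|]; last by case: (b c.+1 _); lia.
by rewrite IHc leqNgt Vs.
Qed.

(* The corners of the paths in the region form the poset of the pairs (c, s)
   with lo c < s <= hi c, where (c, s) <= (c + 1, s) and
   (c, s) <= (c - 1, s - 1); V is encoded by the filter of the pairs with
   s <= V c, and the rank of (c, s) is r + c - 2 s. *)
Theorem path_polytope_gorenstein (R : realType) (m n C r K : nat)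
    (lo hi : nat -> nat) (v : (nat -> nat) -> 'M[R]_(m, n)) :
  unit_steps C lo -> unit_steps C hi -> hi 0%N = 0%N ->
  (forall c, c <= C -> lo c <= hi c)%N -> (0 < K)%N ->
  finite_set [set v V | V in lattice_path C lo hi] ->
  (forall V, lattice_path C lo hi V -> v V \is a mxOver Num.int) ->
  (forall c s, (c <= C)%N -> (lo c < s <= hi c)%N ->
     exists2 g : 'M[R]_(m, n), g \is a mxOver Num.int
     & forall V, lattice_path C lo hi V -> dotmx g (v V) = (s <= V c)%N%:R) ->
  (forall i j, exists2 l : seq (bool * nat * nat),
     forall x, x \in l -> (x.1.2 <= C)%N
     & forall V, lattice_path C lo hi V ->
       v V i j = \sum_(x <- l) (-1) ^+ x.1.1 * (x.2 <= V x.1.2)%N%:R) ->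
  (forall c s, c <= C -> lo c < s <= hi c -> 0 < r + c - s.*2 < K)%N ->
  (forall c s, c <= C -> lo c < s <= hi c ->
    [\/ r + c = s.*2.+1, 0 < c /\ s <= hi c.-1 | c < C /\ s < hi c.+1])%N ->
  (forall c s, c <= C -> lo c < s <= hi c ->
    [\/ (r + c - s.*2).+1 = K, c < C /\ lo c.+1 < s | lo c.-1 < s.-1])%N ->
  gorenstein (conv_hull [set v V | V in lattice_path C lo hi]).
Proof.
move=> lo_steps hi_steps hi0 lohi K_gt0 vfin vZ vy yv rkK down up.
pose T := {V | lattice_path C lo hi V}.
have hi_le c : (c <= C -> hi c <= c)%N.
  by move=> cC; have := @unit_steps_le C hi 0 c hi_steps; rewrite hi0; lia.
pose D c s := (lo c < s <= hi c)%N.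
pose I : finType := {p : 'I_C.+1 * 'I_C.+1 | D p.1 p.2}.
pose X (p : I) : nat := (val p).1; pose Y (p : I) : nat := (val p).2.
have XC p : (X p <= C)%N by rewrite -ltnS ltn_ord.
have XY p : D (X p) (Y p) by exact: (valP p).
have mkI c s : (c <= C)%N -> D c s -> exists p : I, X p = c /\ Y p = s.
  move=> cC cs; have cC' : (c < C.+1)%N by [].
  have sC : (s < C.+1)%N by have := hi_le c cC; move: cs; rewrite /D; lia.
  by exists (exist (fun p : 'I_C.+1 * 'I_C.+1 => D p.1 p.2)
    (Ordinal cC', Ordinal sC) cs).
have XYinj p q : X p = X q -> Y p = Y q -> p = q.
  rewrite /X /Y => Xpq Ypq; apply: val_inj.
  rewrite [val p]surjective_pairing [val q]surjective_pairing.
  by congr pair; apply: val_inj.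
pose y (t : T) (p : I) := (Y p <= projT1 t (X p))%N.
pose e (p q : I) := ((X q == (X p).+1) && (Y q == Y p))
                 || ((X p == (X q).+1) && (Y p == (Y q).+1)).
have -> : [set v V | V in lattice_path C lo hi] =
    range (fun t : T => v (projT1 t)).
  apply/seteqP; split=> [_ [V VP <-]|_ [[V VP] _ <-]]; last by exists V.
  by exists (exist _ V VP).
apply: (@order_polytope_gorenstein R m n T (fun t => v (projT1 t)) I y e
  (fun p => r + X p - (Y p).*2)%N K) => //.
- apply: sub_finite_set vfin => _ [[V VP] _ <-]; by exists V.
- by case=> V VP; exact: vZ.
- move=> p; have [g gZ gv] := vy _ _ (XC p) (XY p).
  by exists g => // -[V VP]; exact: gv.
- move=> i j; have [l lC vl] := yv i j.
  suff [c [a [cZ aZ E]]] : exists (c : R) (a : I -> R), [/\ c \is a Num.int,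
      forall p, a p \is a Num.int & forall t : T,
      \sum_(x <- l) (-1) ^+ x.1.1 * (x.2 <= projT1 t x.1.2)%N%:R =
      c + \sum_p a p * (y t p)%:R].
    by exists c, a; split=> // t; rewrite -E; apply: vl; exact: (projT2 t).
  elim: l lC {vl} => [|[[s c] h] l IHl] lC.
    exists 0, (fun=> 0); split=> [||t]; rewrite ?rpred0 //.
    by rewrite big_nil big1 ?addr0 // => p _; rewrite mul0r.
  have [|c0 [a [c0Z aZ E]]] := IHl.
    by move=> x xl; apply: lC; rewrite inE xl orbT.
  have /= cC := lC _ (mem_head _ _).
  (* Inside the region the pair is a coordinate; outside, its truth value is the same for all paths
     and joins the constant. *)
  have [/(mkI _ _ cC) [p [pc ph]]|notD] := boolP (D c h).
    exists c0, (fun q => (q == p)%:R * (-1) ^+ s + a q); split=> // [q|t].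
      by rewrite rpredD ?rpredM ?rpred_nat ?rpred_sign.
    rewrite big_cons E /= addrCA; congr (_ + _).
    under [RHS]eq_bigr do rewrite mulrDl; rewrite big_split /=; congr (_ + _).
    rewrite (bigD1 p) //= big1 ?addr0 => [|q /negPf ->]; last by rewrite !mul0r.
    by rewrite eqxx mul1r /y pc ph.
  exists ((-1) ^+ s * (h <= lo c)%N%:R + c0), a; split=> // [|t].
    by rewrite rpredD ?rpredM ?rpred_nat ?rpred_sign.
  rewrite big_cons E /= addrA; congr (_ * _%:R + _ + _); congr nat_of_bool.
  by case: t => V [_ /(_ c cC)] /=; move: notD; rewrite /D; lia.
- move=> p q epq; have := rkK _ _ (XC p) (XY p); have := rkK _ _ (XC q) (XY q).
  case/orP: epq => /andP[/eqP-> /eqP->]; lia.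
- by move=> p; exact: (rkK _ _ (XC p) (XY p)).
- move=> p; have := XC p; have := XY p; rewrite /D => XYp XCp.
  case: (down _ _ XCp XYp) => [|[X0 h]|[XltC h]]; first by left; lia.
  + have [|q [Xq Yq]] := mkI (X p).-1 (Y p) (leq_trans (leq_pred _) XCp).
      by rewrite /D; have := lo_steps (X p).-1; rewrite prednK //; lia.
    by right; exists q; rewrite /e Xq Yq; lia.
  + have [|q [Xq Yq]] := mkI (X p).+1 (Y p).+1 XltC.
      by rewrite /D; have := lo_steps (X p); lia.
    by right; exists q; rewrite /e Xq Yq; lia.
- move=> p; have := XC p; have := XY p; rewrite /D => XYp XCp.
  case: (up _ _ XCp XYp) => [|[XltC h]|h]; first by left.
  + have [|q [Xq Yq]] := mkI (X p).+1 (Y p) XltC.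
      by rewrite /D; have := hi_steps (X p); lia.
    by right; exists q; rewrite /e Xq Yq; lia.
  + have X_gt0 : (0 < X p)%N by have := hi_le _ XCp; lia.
    have [|q [Xq Yq]] := mkI (X p).-1 (Y p).-1 (leq_trans (leq_pred _) XCp).
      by rewrite /D; have := hi_steps (X p).-1; rewrite prednK //; lia.
    by right; exists q; rewrite /e Xq Yq; lia.
- move=> [V VP] p q; have [Vs _] := VP; rewrite /y /=.
  move=> /orP[/andP[/eqP Xq /eqP Yq]|/andP[/eqP Xp /eqP Yp]].
    by rewrite Xq Yq; have := Vs (X p); have := XC q; lia.
  by rewrite Xp Yp; have := Vs (X q); have := XC p; lia.
move=> b b_mono.
(* Outside the region b' is true up to lo and false above hi, as it is for every path of the
   region. *)
pose b' c s := if [pick p | (X p == c) && (Y p == s)] is Some p then b p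
               else (s <= lo c)%N.
have b'D p c s : X p = c -> Y p = s -> b' c s = b p.
  rewrite /b' => pc ps; case: pickP => [q /andP[/eqP qc /eqP qs]|/(_ p)].
    by congr b; apply: XYinj; rewrite ?qc ?qs.
  by rewrite pc ps !eqxx.
have b'N c s : ~~ D c s -> b' c s = (s <= lo c)%N.
  rewrite /b' => nD; case: pickP => // q /andP[/eqP qc /eqP qs].
  by move: nD; rewrite -qc -qs XY.
have [|||V Vs bV] := @path_of_filter C b'.
- move=> s; rewrite b'N; last by rewrite /D hi0; lia.
  by have := lohi 0%N; rewrite hi0; lia.
- move=> c s cC; have := lo_steps c cC; have := hi_steps c cC => hs ls.
  have [Dcs|nD] := boolP (D c s); have [Dcs'|nD'] := boolP (D c.+1 s).
  + have [p [pc ps]] := mkI _ _ (ltnW cC) Dcs; have [q [qc qs]] := mkI _ _ cC Dcs'.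
    rewrite (b'D p c s) // (b'D q c.+1 s) //; apply: b_mono; rewrite /e; lia.
  + by rewrite (b'N c.+1) //; move: Dcs nD'; rewrite /D; lia.
  + by rewrite b'N //; move: nD Dcs'; rewrite /D; lia.
  + by rewrite !b'N //; lia.
- move=> c s cC; have := lo_steps c cC; have := hi_steps c cC => hs ls.
  have [Dcs|nD] := boolP (D c s); have [Dcs'|nD'] := boolP (D c.+1 s.+1).
  + have [p [pc ps]] := mkI _ _ (ltnW cC) Dcs; have [q [qc qs]] := mkI _ _ cC Dcs'.
    rewrite (b'D p c s) // (b'D q c.+1 s.+1) //; apply: b_mono; rewrite /e; lia.
  + by rewrite (b'N c.+1) //; move: Dcs nD'; rewrite /D; lia.
  + by rewrite (b'N c) //; move: nD Dcs'; rewrite /D; lia.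
  + by rewrite !b'N //; lia.
have VP : lattice_path C lo hi V.
  split=> // c cC; have := lohi c cC => lohic.
  rewrite -bV // b'N ?leqnn /=; last by rewrite /D ltnn.
  by rewrite leqNgt -bV // b'N /D; lia.
by exists (exist _ V VP) => p; rewrite /y /= -bV // (b'D p).
Qed.

(** * Permutations avoiding 132 and 312 *)

(** Containment compares all ordered pairs; as letters are distinct, the reversed comparisons follow
    from these three. *)
Lemma avoids3P (a b c n : nat) (s : 'S_n) : uniq [:: a; b; c] ->
  avoids [:: a; b; c] s <-> forall i j k : 'I_n, (i < j < k)%N ->
    ~ [/\ (s i < s j)%N = (a < b)%N, (s i < s k)%N = (a < c)%N
        & (s j < s k)%N = (b < c)%N].
Proof.
rewrite /= !inE => abc; split=> [/existsP av i j k ijk [sij sik sjk]|av].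
  apply: av; exists [ffun h : 'I_3 => nth i [:: i; j; k] h].
  have sneq (x y : 'I_n) : (x < y)%N -> (s x : nat) <> s y.
    by move=> xy /val_inj/perm_inj xE; move: xy; rewrite xE ltnn.
  have [/andP[/sneq s_ij /sneq s_jk] /sneq s_ik] :
    (i < j < k)%N /\ (i < k)%N by split=> //; lia.
  apply/forallP => -[[|[|[|x]]] hx] //; apply/forallP => -[[|[|[|z]]] hz] //;
    rewrite !ffunE /=; lia.
apply/existsP => -[f /forallP fP].
have f01 := forallP (fP (inord 0 : 'I_3)) (inord 1 : 'I_3).
have f12 := forallP (fP (inord 1 : 'I_3)) (inord 2 : 'I_3).
have f02 := forallP (fP (inord 0 : 'I_3)) (inord 2 : 'I_3).
apply: (av (f (inord 0 : 'I_3)) (f (inord 1 : 'I_3)) (f (inord 2 : 'I_3))).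
  by move: f01 f12; rewrite !inordK //=; lia.
move: f01 f12 f02; rewrite !inordK //=.
by move=> /andP[_ /eqP->] /andP[_ /eqP->] /andP[_ /eqP->].
Qed.

Lemma dotmx_indicator (R : realType) (m n : nat) (A : pred 'I_m) (B : pred 'I_n)
    (x : 'M[R]_(m, n)) :
  dotmx (\matrix_(i, j) (A i && B j)%:R) x =
  \sum_(i | A i) \sum_(j | B j) x i j.
Proof.
rewrite /dotmx [RHS]big_mkcond; apply: eq_bigr => i _.
case: ifP => Ai; last by rewrite big1 // => j _; rewrite mxE Ai mul0r.
rewrite [RHS]big_mkcond; apply: eq_bigr => j _; rewrite mxE Ai /=.
by case: (B j); rewrite ?mul1r ?mul0r.
Qed.

Lemma telescope_ord (V : zmodType) (n k : nat) (F : nat -> V) : (k <= n)%N ->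
  \sum_(i < n | (i < k)%N) (F i.+1 - F i) = F k - F 0%N.
Proof.
move=> kn; rewrite -(big_ord_widen n (fun i => F i.+1 - F i) kn).
by rewrite -(big_mkord xpredT (fun i => F i.+1 - F i)) telescope_sumr.
Qed.

(* In a word avoiding 132 and 312 every letter is the minimum or the maximum of
   the prefix that it ends, so prefixes are intervals. *)
Lemma prefix_interval (f m : nat -> nat) (k : nat) : f 0%N = m 0%N ->
  (forall i, i < k -> m i.+1 = minn (m i) (f i) /\
     ((f i).+1 = m i \/ f i = m i + i))%N ->
  forall j, (j \in [seq f i | i <- iota 0 k]) = (m k <= j < m k + k)%N.
Proof.
move=> f0; elim: k => [|k IHk] fm j; first by rewrite in_nil; lia.
rewrite -addn1 iotaD map_cat mem_cat IHk => [|i ik]; last by apply: fm; lia.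
rewrite add0n /= inE addn1; have [-> fk] := fm k (ltnSn k).
by case: k {IHk fm} fk => [|k] fk; [rewrite f0|]; lia.
Qed.

Section B_132_312.
Variables (R : realType) (n : nat).

(** [V (rowpos k)] is the minimum of the first k letters. These minima decrease with k, so the path
    reads prefixes from the longest down; the empty prefix is treated as the prefix of length 1. *)
Let rowpos (k : nat) := (n - maxn k 1)%N.

(** With m the prefix minimum, this is the indicator of m <= j < m + k: the value j occurs among the
    first k letters. *)
Let F (V : nat -> nat) (j k : nat) : R :=
  (j.+1 - k <= V (rowpos k))%N%:R - (j.+1 <= V (rowpos k))%N%:R.

Definition interval_path_mx (V : nat -> nat) : 'M[R]_n :=
  \matrix_(i, j) (F V j i.+1 - F V j i).

Let path := lattice_path n.-1 (fun=> 0%N) id.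

(** The first n - c entries of column j = s - 1 + (n - c) sum to [s <= V c] - [s + (n - c) <= V c].
    Recursion on larger s cancels the second term, and ends because [V c <= c]. *)
Lemma interval_path_mx_functional (c s : nat) : (c <= n.-1)%N ->
  (0 < s <= c)%N -> exists2 g : 'M[R]_n, g \is a mxOver Num.int &
  forall V, path V -> dotmx g (interval_path_mx V) = (s <= V c)%N%:R.
Proof.
move=> cn /andP[s_gt0 sc]; have n_gt0 : (0 < n)%N by lia.
have [d] := ubnP (n - s)%N; elim: d s s_gt0 {sc} => // d IHd s s_gt0 sd.
have [sc|cs] := leqP s c; last first.
  exists 0; first by apply/mxOverP => a b; rewrite mxE rpred0.
  move=> V [_ /(_ c cn)/andP[_ Vc]]; rewrite dotmxC linear0.
  by rewrite leqNgt (leq_ltn_trans Vc cs).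
have [||g gZ gV] := IHd (s + (n - c))%N; [lia|lia|].
have jn : (s.-1 + (n - c) < n)%N by lia.
pose j := Ordinal jn.
exists (g + \matrix_(a, b) ((a < n - c)%N && (b == j))%:R).
  apply/mxOverP => a b; rewrite !mxE rpredD ?rpred_nat //.
  exact: (mxOverP gZ).
move=> V VP; rewrite dotmxC linearD /= dotmxC gV // [X in _ + X]dotmxC.
rewrite (dotmx_indicator (fun a : 'I_n => (a < n - c)%N)).
under eq_bigr => a _ do rewrite big_pred1_eq mxE.
rewrite (telescope_ord (F V j)) ?leq_subr // /F /rowpos subn0 subrr subr0.
have -> : (n - maxn (n - c) 1)%N = c by lia.
have -> : (j.+1 - (n - c))%N = s by rewrite /=; lia.
have -> : j.+1 = (s + (n - c))%N by rewrite /=; lia.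
by rewrite addrC subrK.
Qed.

Lemma interval_path_mx_entry (V : nat -> nat) (i j : 'I_n) :
  interval_path_mx V i j = \sum_(x <- [::
    (false, rowpos i.+1, j - i); (true, rowpos i.+1, j.+1);
    (true, rowpos i, j.+1 - i); (false, rowpos i, j.+1)]%N)
    (-1) ^+ x.1.1 * (x.2 <= V x.1.2)%N%:R.
Proof.
by rewrite mxE /F !big_cons big_nil /= expr0 expr1 subSS; ring.
Qed.

End B_132_312.

Lemma interval_path_mx_perm (R : realType) (n : nat) (V : nat -> nat)
    (f : nat -> nat) (s : 'S_n) :
  let m k := V (n - maxn k 1)%N in
  (forall i, i < n -> m i.+1 = minn (m i) (f i) /\
     ((f i).+1 = m i \/ f i = m i + i))%N ->
  (forall i : 'I_n, s i = f i :> nat) -> interval_path_mx R n V = perm_mx s.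
Proof.
move=> m mf sf; apply/matrixP => i j; rewrite !mxE -val_eqE /= sf -!/(m _).
have [mi fi] := mf i (ltn_ord i).
(* This is the equation of the entries with the negative terms moved across. *)
have : ((j.+1 - i.+1 <= m i.+1) + (j.+1 <= m i) =
   (f i == j) + (j.+1 <= m i.+1) + (j.+1 - i <= m i))%N by rewrite mi; lia.
by move/(congr1 (fun k => k%:R : R)); rewrite !natrD; lra.
Qed.

Definition avoids_132_312 (n : nat) (s : 'S_n) : bool :=
  avoids [:: 1; 3; 2]%N s && avoids [:: 3; 1; 2]%N s.

(** Inductively each prefix fills an interval. If the next letter is not adjacent to it, the skipped
    adjacent value on that side comes later, and forms 312 or 132 with the first letter and this
    one. *)
Lemma avoids_132_312_path (R : realType) (n : nat) (s : 'S_n) :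
  avoids_132_312 s -> exists2 V, lattice_path n.-1 (fun=> 0%N) id V &
  interval_path_mx R n V = perm_mx s.
Proof.
case: n s => [|n] s /andP[/avoids3P av132 /avoids3P av312].
  exists (fun=> 0%N); first by split=> // -[].
  by apply/matrixP => -[].
pose f k : nat := s (inord k).
have fE (i : 'I_n.+1) : s i = f i :> nat by rewrite /f inord_val.
(* The default [m 0 = f 0] agrees with [m 1], as in the convention for the empty prefix. *)
pose m := fix m k := if k is k'.+1 then minn (m k') (f k') else f 0%N.
have fn k : (f k <= n)%N by rewrite -ltnS ltn_ord.
have f_inj i j : (i <= n -> j <= n -> f i = f j -> i = j)%N.
  move=> i_n jn /val_inj/perm_inj/(congr1 val); by rewrite /= !inordK.
have f_surj x : (x <= n)%N -> exists2 i, (i <= n)%N & f i = x.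
  move=> xn; exists ((s^-1)%g (inord x) : nat); first by rewrite -ltnS.
  by rewrite -fE permKV inordK.
have fm k : (k <= n.+1)%N -> forall i, (i < k)%N ->
    m i.+1 = minn (m i) (f i) /\ ((f i).+1 = m i \/ f i = (m i + i)%N).
  elim: k => // k IHk kn i; rewrite ltnS leq_eqVlt => /predU1P[->|ik]; last first.
    by apply: IHk => //; exact: ltnW.
  split=> //; case: k kn IHk => [|k] kn IHk; first by right; rewrite addn0.
  have pre := prefix_interval (erefl : f 0%N = m 0%N) (IHk (ltnW kn)).
  have pre_in h : (h < k.+1)%N -> (m k.+1 <= f h < m k.+1 + k.+1)%N.
    by move=> hk; rewrite -pre; apply: map_f; rewrite mem_iota.
  have pre_out h : (k.+1 <= h <= n)%N -> ~~ (m k.+1 <= f h < m k.+1 + k.+1)%N.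
    move=> /andP[kh hn]; rewrite -pre; apply/mapP => -[l].
    by rewrite mem_iota => /andP[_ lk] /f_inj; lia.
  have later x : (x <= n)%N -> x <> f k.+1 ->
      ~~ (m k.+1 <= x < m k.+1 + k.+1)%N ->
      exists2 h, (k.+1 < h <= n)%N & f h = x.
    move=> xn xk xout; have [h hn hx] := f_surj x xn; exists h => //.
    rewrite hn andbT ltn_neqAle; apply/andP; split.
      by apply/eqP => kh; apply: xk; rewrite -hx -kh.
    by rewrite leqNgt; apply/negP => /pre_in; rewrite hx; apply/negP.
  have ltinord a b : (a < b <= n)%N ->
      ((inord a : 'I_n.+1) < (inord b : 'I_n.+1))%N.
    by move=> ab; rewrite !inordK; lia.
  have := pre_out k.+1; rewrite leqnn => /(_ kn); have := pre_in 0%N isT.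
  have [fk_lt|] := ltnP (f k.+1) (m k.+1).
    have [->|ne] := eqVneq (f k.+1).+1 (m k.+1); first by left.
    move=> f0 _; have [|||h hk hx] := later (m k.+1).-1; try by have := fn 0%N; lia.
    have := av312 isT (inord 0) (inord k.+1) (inord h).
    rewrite !ltinord; try by lia.
    by move=> /(_ isT)[]; rewrite -/(f 0%N) -/(f k.+1) -/(f h); split; lia.
  move=> fk_ge f0 fk_out.
  have [->|ne] := eqVneq (f k.+1) (m k.+1 + k.+1)%N; first by right.
  have [|||h hk hx] := later (m k.+1 + k.+1)%N; try by have := fn k.+1; lia.
  have := av132 isT (inord 0) (inord k.+1) (inord h).
  rewrite !ltinord; try by lia.
  by move=> /(_ isT)[]; rewrite -/(f 0%N) -/(f k.+1) -/(f h); split; lia.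
have {}fm := fm _ (leqnn _).
have mn : m n.+1 = 0%N.
  have [h hn hx] := f_surj 0%N (leq0n _).
  have := prefix_interval (erefl : f 0%N = m 0%N) fm (f h).
  by rewrite map_f ?mem_iota // hx; lia.
have m_steps : unit_steps n (fun c => m (n.+1 - c)%N).
  move=> c cn; rewrite subSS (subSn (ltnW cn)).
  have [|mE fE'] := fm (n - c)%N; first by lia.
  by rewrite -/(m _) mE; lia.
exists (fun c => m (n.+1 - c)%N).
  split=> // c cn /=; have := @unit_steps_le n _ 0 c m_steps.
  by rewrite subn0 mn => /(_ cn); lia.
apply: (@interval_path_mx_perm R n.+1 _ f) => // i i_n /=.
have -> : (n.+1 - (n.+1 - maxn i 1))%N = maxn i 1 by lia.
have -> : (n.+1 - (n.+1 - maxn i.+1 1))%N = i.+1 by lia.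
have -> : m (maxn i 1) = m i by case: i {i_n} => //=; rewrite minnn.
exact: fm.
Qed.

(** The word is rebuilt letter by letter: a new minimum where the prefix minimum drops, otherwise
    the value just above the interval. *)
Lemma path_avoids_132_312 (R : realType) (n : nat) (V : nat -> nat) :
  lattice_path n.-1 (fun=> 0%N) id V -> exists2 s : 'S_n,
  avoids_132_312 s & perm_mx s = interval_path_mx R n V.
Proof.
move=> [Vs V0]; pose m k := V (n - maxn k 1)%N.
pose f k := if (m k.+1 < m k)%N then m k.+1 else (m k + k)%N.
have f0 : f 0%N = m 0%N by rewrite /f /m ltnn addn0.
have fm i : (i < n)%N -> m i.+1 = minn (m i) (f i) /\
    ((f i).+1 = m i \/ f i = (m i + i)%N).
  move=> i_n; rewrite /f.
  have : (m i.+1 <= m i <= (m i.+1).+1)%N.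
    case: i i_n => [|i] i_n; first by rewrite /m /maxn /= leqnn leqnSn.
    have := Vs (n - i.+2)%N; rewrite /m /maxn /=.
    rewrite (_ : (n - i.+2).+1 = n - i.+1)%N; lia.
  by case: ltnP; lia.
have pre k : (k <= n)%N ->
    forall j, (j \in [seq f i | i <- iota 0 k]) = (m k <= j < m k + k)%N.
  by move=> kn; apply: prefix_interval f0 _ => i ik; apply: fm; lia.
have pre_in i k : (i < k <= n)%N -> (m k <= f i < m k + k)%N.
  by move=> /andP[ik kn]; rewrite -pre //; apply: map_f; rewrite mem_iota.
have f_out k : (k < n)%N -> (f k).+1 = m k \/ f k = (m k + k)%N by move=> /fm[].
have fn i : (i < n)%N -> (f i < n)%N.
  move=> i_n; have := pre_in i n; rewrite i_n leqnn => /(_ isT).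
  have := V0 0%N; rewrite /m /=; rewrite (_ : n - maxn n 1 = 0)%N; lia.
have f_inj : injective (fun i : 'I_n => Ordinal (fn i (ltn_ord i))).
  suff f_neq (i j : 'I_n) : (i < j)%N -> f i <> f j.
    move=> i j /(congr1 val) /= fij; apply: val_inj.
    by have [/f_neq|/f_neq|] := ltngtP i j; rewrite ?fij.
  move=> ij; have := pre_in i j; have := f_out j (ltn_ord j).
  by have := ltn_ord j; lia.
pose s := perm f_inj.
have sE i : s i = f i :> nat by rewrite permE.
exists s; last by rewrite (@interval_path_mx_perm R n V f s).
(* Both patterns end in their middle letter, whereas each letter here lies below or above all
   earlier ones. *)
by apply/andP; split; apply/avoids3P => // i j k ijk; rewrite !sE;
  have := pre_in i k; have := pre_in j k; have := f_out k (ltn_ord k);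
  have := ltn_ord k => H1 H2 H3 H4 []; lia.
Qed.

Lemma gorenstein_B_132_312 (R : realType) (n : nat) :
  gorenstein (B_132_312 R n).
Proof.
rewrite /B_132_312 /perm_polytope.
set S := (X in conv_hull X).
have Sfin : finite_set S by apply: finite_image; exact: finite_finset.
have SE : S =
    [set interval_path_mx R n V | V in lattice_path n.-1 (fun=> 0%N) id].
  apply/seteqP; split=> [_ [s sA <-]|_ [V VP <-]].
    by have [V VP VE] := avoids_132_312_path R sA; exists V.
  by have [s sA sE] := path_avoids_132_312 R VP; exists s.
rewrite SE in Sfin *.
(* The rank n + c - 2s runs from 1 at (n - 1, n - 1) to 2n - 3 at (n - 1, 1). For n <= 1 the poset
   is empty and K is 1. *)
apply: (@path_polytope_gorenstein R n n n.-1 n (n.*2 - 3).+1) => //.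
- by move=> c _; rewrite leqnn leqnSn.
- move=> V _; apply/mxOverP => i j; rewrite interval_path_mx_entry.
  by apply: rpred_sum => x _; rewrite rpredM ?rpred_sign ?rpred_nat.
- move=> c s cn sc; exact: interval_path_mx_functional.
- move=> i j; eexists; last by move=> V _; exact: interval_path_mx_entry.
  by move=> x; rewrite !inE => /or4P[] /eqP -> /=; lia.
- by move=> c s; lia.
- move=> c s cn sc; have [e|ne] := eqVneq (n + c)%N s.*2.+1; first exact: Or31.
  have [e|ne'] := eqVneq s c; [apply: Or33|apply: Or32]; lia.
- move=> c s cn sc; have [e|ne] := eqVneq (n + c - s.*2).+1 (n.*2 - 3).+1.
    exact: Or31.
  have [e|ne'] := eqVneq s 1%N; [apply: Or32|apply: Or33]; lia.
Qed.

(** * Alternating permutations avoiding 123 *)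

(* In an alternating word avoiding 123 the valleys decrease, and so do the other
   letters: the peaks and, if n is odd, the last letter.  The path counts the
   valleys with value less than c. *)
Definition valley (n i : nat) : bool := ~~ odd i && (i.+1 < n)%N.

(** This says that the letter at i is less than c. Valleys decrease, so a valley is below c iff it
    and all later ones are among the [V c] valleys below c; likewise for the c - V c other
    letters. *)
Definition below (n : nat) (V : nat -> nat) (i c : nat) : bool :=
  if valley n i then (n./2 - i./2 <= V c)%N else (uphalf n + V c <= c + i./2)%N.

(** There are [n./2] valleys. A peak below c has the valley before it below c, and only the last
    letter for odd n lacks such a partner: hence c - V c <= V c + odd n. *)
Definition alt_path (n : nat) : (nat -> nat) -> Prop :=
  lattice_path n (fun c => uphalf (c - odd n)) (fun c => minn c n./2).

Definition valley_path_mx (R : realType) (n : nat) (V : nat -> nat) : 'M[R]_n :=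
  \matrix_(i, j) ((below n V i j.+1)%:R - (below n V i j)%:R).

(** Row i is that of the s-th smallest valley; its first c entries sum to [s <= V c]. *)
Lemma valley_path_mx_functional (R : realType) (n c s : nat) : (c <= n)%N ->
  (0 < s <= n./2)%N -> exists2 g : 'M[R]_n, g \is a mxOver Num.int &
  forall V, alt_path n V -> dotmx g (valley_path_mx R n V) = (s <= V c)%N%:R.
Proof.
move=> cn /andP[s_gt0 sL].
have i_n : ((n./2 - s).*2 < n)%N by lia.
pose i := Ordinal i_n.
exists (\matrix_(a, b) ((a == i) && (b < c)%N)%:R).
  by apply/mxOverP => a b; rewrite mxE rpred_nat.
move=> V [_ /(_ 0%N isT)/andP[_]]; rewrite min0n leqn0 => /eqP V0.
rewrite (dotmx_indicator _ (fun b : 'I_n => (b < c)%N)) big_pred1_eq.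
under eq_bigr => b _ do rewrite mxE.
rewrite (telescope_ord (fun c => (below n V i c)%:R)) //.
have belowE d : below n V i d = (s <= V d)%N.
  rewrite /below /valley /= odd_double doubleK /=.
  by rewrite ifT; lia.
by rewrite !belowE V0 leqn0 eqn0Ngt s_gt0 subr0.
Qed.

Lemma valley_path_mx_entry (R : realType) (n : nat) (V : nat -> nat)
    (i j : 'I_n) :
  valley_path_mx R n V i j = \sum_(x <- if valley n i
    then [:: (false, j.+1, n./2 - i./2); (true, nat_of_ord j, n./2 - i./2)]%N
    else [:: (false, nat_of_ord j, (j + i./2).+1 - uphalf n);
             (true, j.+1, (j.+1 + i./2).+1 - uphalf n)]%N)
    (-1) ^+ x.1.1 * (x.2 <= V x.1.2)%N%:R.
Proof.
rewrite mxE /below; case: ifP => _; rewrite !big_cons big_nil /= expr0 expr1.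
  by ring.
(* For the other letters the condition is the negation of a path condition; the constants 1 cancel
   in the difference. *)
have belowE c : ((uphalf n + V c <= c + i./2)%N)%:R =
    1 - ((c + i./2).+1 - uphalf n <= V c)%N%:R :> R.
  have -> : ((c + i./2).+1 - uphalf n <= V c)%N =
      ~~ (uphalf n + V c <= c + i./2)%N.
    by lia.
  by case: (_ <= _)%N; rewrite ?subrr ?subr0.
by rewrite !belowE; ring.
Qed.

Lemma valley_path_mx_perm (R : realType) (n : nat) (V : nat -> nat) (s : 'S_n) :
  (forall (i : 'I_n) c, (c <= n)%N -> (s i < c)%N = below n V i c) ->
  valley_path_mx R n V = perm_mx s.
Proof.
move=> sV; apply/matrixP => i j; rewrite !mxE.
rewrite -(sV i j.+1) // -(sV i j) ?(ltnW (ltn_ord j)) // ltnS -val_eqE /=.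
have [ij|ji|ij] := ltngtP (s i) j.
- by rewrite subrr.
- by rewrite subrr.
- by rewrite subr0.
Qed.

Definition alternating_avoids_123 (n : nat) (s : 'S_n) : bool :=
  alternating s && avoids [:: 1; 2; 3]%N s.

(** Values are read upwards: each one is the rightmost unread valley or the rightmost unread other
    letter, so the count of valleys determines the positions. *)
Lemma alternating_avoids_123_path (R : realType) (n : nat) (s : 'S_n) :
  alternating_avoids_123 s ->
  exists2 V, alt_path n V & valley_path_mx R n V = perm_mx s.
Proof.
case: n s => [|n] s /andP[/forallP alt /avoids3P av].
  exists (fun=> 0%N); last by apply/matrixP => -[].
  by split=> // c; rewrite leqn0 => /eqP->.
pose N := n.+1; pose f k : nat := s (inord k).
have fE (i : 'I_n.+1) : s i = f i :> nat by rewrite /f inord_val.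
have f_inj i j : (i <= n -> j <= n -> f i = f j -> i = j)%N.
  move=> i_n jn /val_inj/perm_inj/(congr1 val); by rewrite /= !inordK.
have f_surj x : (x <= n)%N -> exists2 i, (i <= n)%N & f i = x.
  move=> xn; exists ((s^-1)%g (inord x) : nat); first by rewrite -ltnS.
  by rewrite -fE permKV inordK.
have f_alt i : (i < n)%N ->
    if odd i then (f i.+1 < f i)%N else (f i < f i.+1)%N.
  move=> i_n; have /forallP/(_ (inord i.+1)) := alt (inord i).
  by rewrite !inordK ?ltnS ?eqxx //; exact: ltnW.
have f_av i j k : (i < j < k)%N -> (k <= n)%N -> (f i < f j < f k)%N -> False.
  move=> ijk kn fijk; apply: (av isT (inord i) (inord j) (inord k)).
    by rewrite !inordK //; lia.
  by rewrite -/(f i) -/(f j) -/(f k); split; lia.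
have f_neq i j : (i < j <= n)%N -> f i <> f j by move=> ij /f_inj; lia.
(* Otherwise positions i, i + 2, i + 3 would form 123; for peaks, positions i - 1, i, i + 2
   would. *)
have valley_dec i : (i.+3 <= n)%N -> ~~ odd i -> (f i.+2 < f i)%N.
  move=> i_n ev; have := f_alt i.+2; have := f_av i i.+2 i.+3.
  by have := f_neq i i.+2; rewrite /= negbK (negPf ev); lia.
have peak_dec i : (i.+2 <= n)%N -> odd i -> (f i.+2 < f i)%N.
  case: i => // i i_n /= ev; have := f_alt i; have := f_av i i.+1 i.+3.
  by have := f_neq i.+1 i.+3; rewrite (negPf ev); lia.
pose V := fix V c := if c is c'.+1
  then (V c' + valley N ((s^-1)%g (inord c')))%N else 0%N.
have VS c : V c.+1 = (V c + valley N ((s^-1)%g (inord c)))%N by [].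
have VP c : (c <= N)%N -> [/\ V c <= N./2, c <= (V c).*2 + odd N, V c <= c
    & forall i, (i <= n) -> (f i < c) = below N V i c]%N.
  elim: c => [|c IHc] cN.
    have V0 : V 0%N = 0%N by [].
    split=> // i i_n; rewrite ltn0 /below /valley /N V0.
    by case: ifP; lia.
  have [VL lo Vc fV] := IHc (ltnW cN).
  have [p pn fp] := f_surj c cN.
  have {}VS : V c.+1 = (V c + valley N p)%N.
    rewrite VS; congr (_ + valley _ _)%N; rewrite -[RHS](inordK (_ : p < n.+1)%N) //.
    congr nat_of_ord; apply: (@perm_inj _ s); rewrite permKV; apply: val_inj.
    by rewrite /= -/(f p) fp inordK.
  have f_lt i : (i <= n)%N -> (f i < c.+1)%N = (f i < c)%N || (i == p).
    move=> i_n; rewrite ltnS leq_eqVlt orbC -fp; congr orb.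
    by apply/eqP/eqP => [/f_inj->|->].
  have := fV p pn; rewrite fp ltnn => /esym; rewrite {1}/below.
  have [vp|nvp] := boolP (valley N p) => VcN; rewrite VS.
    (* The next valley to the right of p is already below c, while p itself is not. *)
    have Vc1 : V c = (N./2 - p./2).-1.
      have : ((p.+3 <= n)%N -> (N./2 - p.+2./2 <= V c)%N).
        move=> p3; have := fV p.+2; rewrite /below ifT.
          by have := valley_dec p p3; move: vp; rewrite fp /valley => /andP[ev _];
            move=> /(_ ev) -> /(_ (ltnW p3)) <-.
        by move: vp; rewrite /valley /N /= negbK; lia.
      by move: vp VcN; rewrite /valley /N; lia.
    split; [by move: vp VcN; rewrite /valley /N; lia|by lia|by lia|].
    move=> i i_n; rewrite f_lt // fV // /below VS.
    move: vp VcN Vc1; rewrite /valley /N; case: ifP; lia.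
  (* The same for non-valleys: the next one is a peak or the last letter, unless p is last. *)
  have Vc1 : (c + p./2).+1 = (uphalf N + V c)%N.
    have [p2|p2] := leqP p.+2 n.
      have op : odd p by move: nvp; rewrite /valley /N; lia.
      have := fV p.+2 p2; have := peak_dec p p2 op.
      rewrite fp /below /valley /= negbK op => -> /esym.
      by move: VcN; lia.
    have [p1|p1] := leqP p.+1 n; last by move: nvp VcN; rewrite /valley /N; lia.
    have op : odd p by move: nvp; rewrite /valley /N; lia.
    have := fV p.+1 p1; have := f_alt p p1; rewrite op fp => -> /esym.
    by rewrite /below /valley /N; case: ifP; move: VcN; rewrite /N; lia.
  (* The valley just before a peak p is smaller, hence already counted by [V c]. *)
  have lo' : (c.+1 <= (V c).*2 + odd N)%N.
    have [op|ep] := boolP (odd p); last by move: nvp Vc1; rewrite /valley /N; lia.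
    case: (p) op pn fp Vc1 => // q /= oq qn fq Vc1.
    have := fV q (ltnW qn); have := f_alt q qn; rewrite (negPf oq) fq => -> /esym.
    by rewrite /below /valley /N; case: ifP; move: Vc1; rewrite /N; lia.
  have {}VS : V c.+1 = V c by rewrite VS (negPf nvp) addn0.
  rewrite (negPf nvp) addn0; split=> //; first exact: leqW.
  move=> i i_n; rewrite f_lt // fV // /below VS.
  move: nvp VcN Vc1; rewrite /valley /N; case: ifP; lia.
exists V.
  split=> [c cN|c cN]; first by rewrite VS; case: valley; lia.
  by have [? ? ? ?] := VP c cN; lia.
apply: valley_path_mx_perm => i c cN; rewrite fE.
by have [_ _ _ ->] := VP c cN; rewrite // -ltnS.
Qed.

(** The letter at i is the threshold where [below n V i] turns from false to true. *)
Lemma alt_path_perm (R : realType) (n : nat) (V : nat -> nat) :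
  alt_path n V -> exists2 s : 'S_n,
  alternating_avoids_123 s & perm_mx s = valley_path_mx R n V.
Proof.
move=> [Vs Vlh].
have V_le a c : (a <= c <= n)%N -> (V a <= V c <= V a + (c - a))%N.
  by move=> ac; apply: unit_steps_le ac.
have thr (i : 'I_n) : exists j : 'I_n, forall c, (c <= n)%N ->
    (j < c)%N = below n V i c.
  have i_n := ltn_ord i; have ex : exists c, below n V i c.+1 || (n <= c.+1)%N.
    by exists n; rewrite leqnSn orbT.
  have [j jP jmin] := ex_minnP ex.
  have jn : (j < n)%N.
    by have := jmin n.-1; rewrite prednK ?leqnn ?orbT //; lia.
  exists (Ordinal jn) => c cn /=.
  have b0 : below n V i 0 = false.
    by have := Vlh 0%N isT; rewrite /below /valley min0n; case: ifP; lia.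
  have bn : below n V i n.
    by have := Vlh n (leqnn _); rewrite /below /valley; case: ifP; lia.
  have bj : below n V i j.+1.
    by case/orP: jP => // nj; rewrite (_ : j.+1 = n) //; lia.
  case: c cn => [|c] cn; first by rewrite b0.
  rewrite ltnS; apply/idP/idP => [jc|bc]; last by apply: jmin; rewrite bc.
  have := V_le j.+1 c.+1; rewrite ltnS jc cn => /(_ isT).
  by move: bj; rewrite /below; case: ifP; lia.
pose f i := projT1 (cid (thr i)).
have fP i c : (c <= n)%N -> (f i < c)%N = below n V i c.
  exact: (projT2 (cid (thr i))).
have step (i : 'I_n) : below n V i (f i).+1 /\ ~~ below n V i (f i).
  by rewrite -!fP ?ltnn ?ltnSn // ltnW.
(* At each step only one class can switch: valleys when V rises, other letters when it stays. Within
   a class the thresholds differ. *)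
have f_inj : injective f.
  move=> i j fij; apply: val_inj => /=; have i_n := ltn_ord i; have jn := ltn_ord j.
  have [i1 i0] := step i; have [j1 j0] := step j; rewrite -fij in j1 j0.
  have := Vs _ (ltn_ord (f i)).
  by move: i1 i0 j1 j0; rewrite /below /valley; case: ifP; case: ifP; lia.
pose s := perm f_inj.
have sV (i : 'I_n) c : (c <= n)%N -> (s i < c)%N = below n V i c.
  by rewrite permE; exact: fP.
exists s; last by rewrite (valley_path_mx_perm R sV).
have s_below (i j : 'I_n) : i != j -> below n V j (s i).+1 -> (s j < s i)%N.
  move=> ij; rewrite -sV ?ltn_ord // ltnS leq_eqVlt val_eqE (inj_eq perm_inj).
  by rewrite eq_sym (negPf ij).
have s_step (i : 'I_n) : below n V i (s i).+1 by rewrite -sV ?ltnSn // ltn_ord.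
have dec (i j : 'I_n) : (i < j)%N -> valley n i = valley n j -> (s j < s i)%N.
  move=> ij ijv; apply: s_below; first by rewrite -val_eqE /= ltn_eqF.
  have := s_step i; rewrite /below ijv.
  have := ltn_ord i; have := ltn_ord j; move: ijv; rewrite /valley.
  by case: ifP; lia.
(* The lower boundary path forces the valley i below its right neighbour. *)
have asc (i j : 'I_n) : j = i.+1 :> nat -> ~~ odd i -> (s i < s j)%N.
  move=> ji ev; apply: s_below; first by rewrite -val_eqE /= ji; lia.
  have := s_step j; rewrite /below /valley ji /= ev /=.
  have := ltn_ord j; have := Vlh (s j).+1 (ltn_ord _); rewrite ji.
  by move: ev; case: ifP; lia.
apply/andP; split.
  apply/forallP => i; apply/forallP => j; apply/implyP => /eqP ji.
  case: ifPn => oi; last exact: asc.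
  (* A descent to a valley j is seen through the peak at j + 1, which exceeds j and is less than the
     peak i. *)
  have [vj|nvj] := boolP (valley n j); last first.
    by apply: dec; [rewrite ji|rewrite (negPf nvj) /valley oi].
  have kn : (j.+1 < n)%N by case/andP: vj.
  apply: (@ltn_trans (s (Ordinal kn))).
    by apply: asc => //; case/andP: vj.
  by apply: dec; rewrite /= ?ji /valley /= ?oi //.
(* Two of three positions are in the same class, and each class decreases. *)
apply/avoids3P => // i j k /andP[ij jk] [].
have valley_neq (x y : 'I_n) : (x < y)%N -> (s x < s y)%N ->
    valley n x <> valley n y.
  by move=> xy sxy /(dec _ _ xy); lia.
move=> /(valley_neq _ _ ij) + /(valley_neq _ _ (ltn_trans ij jk)).
move=> + + /(valley_neq _ _ jk).
by case: (valley n i); case: (valley n j); case: (valley n k).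
Qed.

Lemma gorenstein_Balt_123 (R : realType) (n : nat) : gorenstein (Balt_123 R n).
Proof.
rewrite /Balt_123 /perm_polytope; set S := (X in conv_hull X).
have Sfin : finite_set S by apply: finite_image; exact: finite_finset.
have SE : S = [set valley_path_mx R n V | V in alt_path n].
  apply/seteqP; split=> [_ [s sA <-]|_ [V VP <-]].
    by have [V VP VE] := alternating_avoids_123_path R sA; exists V.
  by have [s sA sE] := alt_path_perm R VP; exists s.
rewrite SE in Sfin *.
(* Rank 1 occurs only at c = s = [n./2]. Above the lower path 2s >= c - odd n + 2, so ranks are at
   most [uphalf n] - 1; the maximum with 1 keeps K positive for n = 0. *)
apply: (@path_polytope_gorenstein R n n n (n./2).+1 (maxn 1 (uphalf n))) => //.
- by move=> c cn; lia.
- by move=> c cn; lia.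
- by rewrite min0n.
- by move=> c cn; lia.
- by lia.
- move=> V _; apply/mxOverP => i j; rewrite mxE.
  by rewrite rpredB ?rpred_nat.
- by move=> c s cn sc; apply: valley_path_mx_functional => //; lia.
- move=> i j; eexists; last by move=> V _; exact: valley_path_mx_entry.
  by move=> x; case: (valley n i); rewrite !inE => /orP[] /eqP -> //=; exact: ltnW.
- by move=> c s; lia.
- move=> c s cn sc; have [e|ne] := eqVneq ((n./2).+1 + c)%N s.*2.+1; first exact: Or31.
  have [e|ne'] := eqVneq s c; [apply: Or33|apply: Or32]; lia.
- move=> c s cn sc.
  have [e|ne] := eqVneq ((n./2).+1 + c - s.*2).+1 (maxn 1 (uphalf n)).
    exact: Or31.
  by apply: Or32; lia.
Qed.

Theorem theorem6p2 (R : realType) (n : nat) :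
  gorenstein (B_132_312 R n) /\ gorenstein (Balt_123 R n).
Proof.
by split; [exact: gorenstein_B_132_312|exact: gorenstein_Balt_123].
Qed.
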